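(* Let $M$ be an $n$-dimensional free $\mathbb{T}$-module. Any two bases of $M$ are related by a nonsingular matrix; that is, if $\{|m_l\rangle\}_{l=1}^n$ and $\{|s_l\rangle\}_{l=1}^n$ are bases of $M$ and $L$ is the $n\times n$ bicomplex matrix with $|m_l\rangle=\sum_{p=1}^n L_{pl}|s_p\rangle$ for all $l$, then $L$ is nonsingular.
   Context: Bicomplex numbers: $\mathbb{T}$ is the commutative ring of elements $w=z_1+z_2\mathbf{i_2}$ with $z_1,z_2\in\mathbb{C}(\mathbf{i_1})=\{x+y\mathbf{i_1}: x,y\in\mathbb{R}\}$ (a copy of the complex field), where $\mathbf{i_1}^2=\mathbf{i_2}^2=-1$ and $\mathbf{i_1}\mathbf{i_2}=\mathbf{i_2}\mathbf{i_1}=\mathbf{j}$, so $\mathbf{j}^2=1$. Put $\mathbf{e_1}=(1+\mathbf{j})/2$, $\mathbf{e_2}=(1-\mathbf{j})/2$; every $w\in\mathbb{T}$ is uniquely $w=\mathbf{e_1}w_{\hat 1}+\mathbf{e_2}w_{\hat 2}$ with $w_{\hat 1},w_{\hat 2}\in\mathbb{C}(\mathbf{i_1})$. The null cone is the set of $w$ with $w_{\hat 1}=0$ or $w_{\hat 2}=0$ (including $w=0$). A bicomplex square matrix (entries in $\mathbb{T}$) is singular if its determinant is in the null cone, and nonsingular otherwise. An $n$-dimensional free $\mathbb{T}$-module is a $\mathbb{T}$-module with a basis (linearly independent generating set) of $n$ elements; all its bases have $n$ elements. *)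

(* Defs.v *)
From HB Require Import structures.
From mathcomp Require Import all_boot all_order all_algebra.
From mathcomp Require Import ring.
From mathcomp Require Import reals.
From mathcomp.real_closed Require Import complex.

Set Implicit Arguments.
Unset Strict Implicit.
Unset Printing Implicit Defensive.

Import GRing.Theory.
Local Open Scope ring_scope.

(* [Bicomplex z1 z2] is z1 + z2 i2, with z1 and z2 in C(i1) = R[i]. A dedicated
   record is needed because pairs carry the componentwise product. *)
Record bicomplex (R : realType) := Bicomplex { bc1 : R[i]; bc2 : R[i] }.

Section BicomplexRing.
Variable R : realType.
Local Notation T := (bicomplex R).

Definition pair_of_bicomplex (w : T) : R[i] * R[i] := (bc1 w, bc2 w).
Definition bicomplex_of_pair (p : R[i] * R[i]) : T := Bicomplex p.1 p.2.

Lemma pair_of_bicomplexK : cancel pair_of_bicomplex bicomplex_of_pair.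
Proof. by case. Qed.

HB.instance Definition _ := Equality.copy T (can_type pair_of_bicomplexK).
HB.instance Definition _ := Choice.copy T (can_type pair_of_bicomplexK).

Definition bc_zero : T := Bicomplex 0 0.
Definition bc_one : T := Bicomplex 1 0.
Definition bc_opp (w : T) : T := Bicomplex (- bc1 w) (- bc2 w).
Definition bc_add (w v : T) : T := Bicomplex (bc1 w + bc1 v) (bc2 w + bc2 v).
Definition bc_mul (w v : T) : T :=
  Bicomplex (bc1 w * bc1 v - bc2 w * bc2 v) (bc1 w * bc2 v + bc2 w * bc1 v).

Lemma bc_addA : associative bc_add.
Proof. by move=> x y z; rewrite /bc_add /= !addrA. Qed.
Lemma bc_addC : commutative bc_add.
Proof. by move=> x y; rewrite /bc_add addrC [bc2 x + _]addrC. Qed.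
Lemma bc_add0 : left_id bc_zero bc_add.
Proof. by case=> a b; rewrite /bc_add /= !add0r. Qed.
Lemma bc_addN : left_inverse bc_zero bc_opp bc_add.
Proof. by case=> a b; rewrite /bc_add /= !addNr. Qed.

HB.instance Definition _ :=
  GRing.isZmodule.Build T bc_addA bc_addC bc_add0 bc_addN.

Lemma bc_mulA : associative bc_mul.
Proof. by move=> x y z; congr Bicomplex => /=; ring. Qed.
Lemma bc_mulC : commutative bc_mul.
Proof. by move=> x y; congr Bicomplex => /=; ring. Qed.
Lemma bc_mul1 : left_id bc_one bc_mul.
Proof. by case=> a b; congr Bicomplex => /=; ring. Qed.
Lemma bc_mulDl : left_distributive bc_mul bc_add.
Proof. by move=> x y z; congr Bicomplex => /=; ring. Qed.
Lemma bc_oner_neq0 : bc_one != 0.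
Proof. by apply/eqP => -[/eqP]; rewrite oner_eq0. Qed.

HB.instance Definition _ := GRing.Zmodule_isComNzRing.Build T
  bc_mulA bc_mulC bc_mul1 bc_mulDl bc_oner_neq0.

End BicomplexRing.

Section Idempotents.
Variable R : realType.
Local Notation T := (bicomplex R).

Definition bcC (z : R[i]) : T := Bicomplex z 0.
Definition bc_i1 : T := bcC 'i%C.
Definition bc_i2 : T := Bicomplex 0 1.
Definition bc_j : T := bc_i1 * bc_i2.
Definition bc_e1 : T := bcC 2^-1 * (1 + bc_j).
Definition bc_e2 : T := bcC 2^-1 * (1 - bc_j).

(* The components w_1^ and w_2^ of w = e1 w_1^ + e2 w_2^; that these formulas
   give the unique such components is [bc_idemE] and [bc_idem_uniq]. *)
Definition bc_idem1 (w : T) : R[i] := bc1 w - bc2 w * 'i%C.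
Definition bc_idem2 (w : T) : R[i] := bc1 w + bc2 w * 'i%C.

Definition null_cone (w : T) : Prop := bc_idem1 w = 0 \/ bc_idem2 w = 0.

Lemma bicomplexP (w v : T) : bc1 w = bc1 v -> bc2 w = bc2 v -> w = v.
Proof. by case: w v => [a b] [c d] /= -> ->. Qed.

Lemma bcE (z1 z2 : R[i]) : Bicomplex z1 z2 = bcC z1 + bcC z2 * bc_i2.
Proof. by apply: bicomplexP => /=; ring. Qed.

Lemma sqr_i1C : ('i%C : R[i]) * 'i%C = -1.
Proof. by rewrite -expr2 sqr_i. Qed.

Lemma bc_i1_sqr : bc_i1 * bc_i1 = -1.
Proof. by apply: bicomplexP; rewrite /= ?sqr_i1C; ring. Qed.

Lemma bc_i2_sqr : bc_i2 * bc_i2 = -1.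
Proof. by apply: bicomplexP => /=; ring. Qed.

Lemma bc_idem_comb (a b : R[i]) : bc_e1 * bcC a + bc_e2 * bcC b =
  Bicomplex ((a + b) / 2) ('i%C * (a - b) / 2).
Proof. by apply: bicomplexP => /=; field. Qed.

Lemma bc_idemE (w : T) : w = bc_e1 * bcC (bc_idem1 w) + bc_e2 * bcC (bc_idem2 w).
Proof.
rewrite bc_idem_comb /bc_idem1 /bc_idem2; apply: bicomplexP => /=; first by field.
set z := bc2 w; set y := bc1 w.
have -> : 'i%C * (y - z * 'i%C - (y + z * 'i%C)) / 2 = - ('i%C * 'i%C) * z
  by field.
by rewrite sqr_i1C opprK mul1r.
Qed.

Lemma bc_idem_uniq (w : T) (a b : R[i]) :
  w = bc_e1 * bcC a + bc_e2 * bcC b -> a = bc_idem1 w /\ b = bc_idem2 w.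
Proof.
move=> ->; rewrite bc_idem_comb /bc_idem1 /bc_idem2 /=.
have -> : 'i%C * (a - b) / 2 * 'i%C = ('i%C * 'i%C) * (a - b) / 2 by ring.
by rewrite sqr_i1C; split; field.
Qed.

End Idempotents.

Definition nonsingular (R : realType) (n : nat) (A : 'M[bicomplex R]_n) : Prop :=
  ~ null_cone (\det A).

Section Bases.
Variables (A : comNzRingType) (M : lmodType A) (n : nat).

Definition lin_indep (b : 'I_n -> M) : Prop :=
  forall c : 'I_n -> A, \sum_(l < n) c l *: b l = 0 -> forall l, c l = 0.

Definition generating (b : 'I_n -> M) : Prop :=
  forall x : M, exists c : 'I_n -> A, x = \sum_(l < n) c l *: b l.

Definition is_basis (b : 'I_n -> M) : Prop := lin_indep b /\ generating b.

End Bases.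

Definition free_of_dim (A : comNzRingType) (M : lmodType A) (n : nat) : Prop :=
  exists b : 'I_n -> M, is_basis b.

(* Main.v *)
Require Import Defs.
From mathcomp Require Import all_boot all_order all_algebra.
From mathcomp Require Import ring.
From mathcomp Require Import reals.
From mathcomp.real_closed Require Import complex.
Import GRing.Theory.
Local Open Scope ring_scope.

(** Expressing each basis in the other gives matrices [L] and [K] with
    [L *m K = 1], so [\det L] is invertible. Since the idempotent components are
    multiplicative and send [1] to [1], an invertible bicomplex number lies
    outside the null cone. *)

(** [bc_idem1] substitutes [- 'i] for [bc_i2]; since [- 'i] also squares to [-1], this respects
    products. *)
Lemma bc_idem1M (R : realType) (w v : bicomplex R) :
  bc_idem1 (w * v) = bc_idem1 w * bc_idem1 v.
Proof.
rewrite /bc_idem1 /=; have := sqr_i1C R; set i : R[i] := 'i%C => ii.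
(* The explicit factor [-1] can be rewritten as [i * i], after which the equality is a polynomial
   identity in a free [i]. *)
transitivity (bc1 w * bc1 v + -1 * (bc2 w * bc2 v)
              - (bc1 w * bc2 v + bc2 w * bc1 v) * i); first by ring.
by rewrite -ii; ring.
Qed.

(** Same argument, now substituting ['i] for [bc_i2]. *)
Lemma bc_idem2M (R : realType) (w v : bicomplex R) :
  bc_idem2 (w * v) = bc_idem2 w * bc_idem2 v.
Proof.
rewrite /bc_idem2 /=; have := sqr_i1C R; set i : R[i] := 'i%C => ii.
transitivity (bc1 w * bc1 v + -1 * (bc2 w * bc2 v)
              + (bc1 w * bc2 v + bc2 w * bc1 v) * i); first by ring.
by rewrite -ii; ring.
Qed.

Lemma bc_idem1_1 (R : realType) : bc_idem1 (1 : bicomplex R) = 1.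
Proof. by rewrite /bc_idem1 /= mul0r subr0. Qed.

Lemma bc_idem2_1 (R : realType) : bc_idem2 (1 : bicomplex R) = 1.
Proof. by rewrite /bc_idem2 /= mul0r addr0. Qed.

Lemma mulr_eq1_null_cone (R : realType) (w v : bicomplex R) :
  w * v = 1 -> ~ null_cone w.
Proof.
move=> wv1 [w0|w0].
- have /eqP := bc_idem1_1 R.
  by rewrite -wv1 bc_idem1M w0 mul0r eq_sym oner_eq0.
- have /eqP := bc_idem2_1 R.
  by rewrite -wv1 bc_idem2M w0 mul0r eq_sym oner_eq0.
Qed.

Section ChangeOfBasis.
Variables (A : comNzRingType) (M : lmodType A) (n : nat).

Lemma generating_matrix (s m : 'I_n -> M) : generating s ->
  exists L : 'M[A]_n, forall l, m l = \sum_(p < n) L p l *: s p.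
Proof.
move=> gen_s; have [c cE] := fin_all_exists (fun l => gen_s (m l)).
(* The indices swap because the coordinates of [m l] form column [l]. *)
exists (\matrix_(p, l) c l p) => l.
by rewrite cE; apply: eq_bigr => p _; rewrite mxE.
Qed.

Lemma lin_indep_inj (s : 'I_n -> M) (c d : 'I_n -> A) : lin_indep s ->
  \sum_(l < n) c l *: s l = \sum_(l < n) d l *: s l -> c =1 d.
Proof.
move=> free_s cd l; apply/eqP; rewrite -subr_eq0; apply/eqP.
apply: (free_s (fun l => c l - d l)).
under eq_bigr do rewrite scalerBl.
by rewrite sumrB cd subrr.
Qed.

(** Going from [s] to [m] and back expands [s p] along [s] with column [p] of [L *m K] as
    coefficients; by independence this is the trivial expansion. *)
Lemma change_of_basis_mulmx (s m : 'I_n -> M) (L K : 'M[A]_n) : lin_indep s ->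
    (forall l, m l = \sum_(p < n) L p l *: s p) ->
    (forall p, s p = \sum_(l < n) K l p *: m l) ->
  L *m K = 1%:M.
Proof.
move=> free_s mE sE; apply/matrixP => q p.
apply: (lin_indep_inj s (fun q => (L *m K) q p) (fun q => 1%:M q p)) => //.
transitivity (s p).
  rewrite [RHS]sE; under [RHS]eq_bigr do rewrite mE scaler_sumr.
  rewrite exchange_big /=; apply: eq_bigr => r _.
  rewrite mxE scaler_suml; apply: eq_bigr => l _.
  by rewrite scalerA mulrC.
(* Column [p] of the identity leaves only the term [s p]. *)
rewrite (bigD1 p) //= mxE eqxx scale1r big1 ?addr0 // => r /negPf rp.
by rewrite mxE rp scale0r.
Qed.

End ChangeOfBasis.

Theorem theorem3p10 (R : realType) (n : nat) (M : lmodType (bicomplex R))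
    (hM : free_of_dim M n) (m s : 'I_n -> M)
    (hm : is_basis m) (hs : is_basis s) :
  (exists L : 'M[bicomplex R]_n, forall l, m l = \sum_(p < n) L p l *: s p) /\
  (forall L : 'M[bicomplex R]_n,
     (forall l, m l = \sum_(p < n) L p l *: s p) -> nonsingular L).
Proof.
case: hm hs => _ gen_m [free_s gen_s].
split=> [|L mE]; first exact: generating_matrix.
have [K sE] := generating_matrix _ _ _ m s gen_m.
(* [\det K] is the inverse of [\det L], as the determinant is multiplicative. *)
apply: (@mulr_eq1_null_cone _ _ (\det K)).
by rewrite -det_mulmx (change_of_basis_mulmx _ _ _ _ _ _ _ free_s mE sE) det1.
Qed.
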